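(* Let $\mathcal{L}$ be a complete modular lattice and let $\mathfrak{m}$ be a submonoid with zero of $\mathrm{End}_{lin}(\mathcal{L})$ that is closed under complements. The following conditions are equivalent: (a) $\mathcal{L}$ is $\mathfrak{m}$-abelian-endoregular. (b) $\mathcal{L}$ is $\mathfrak{m}$-endoregular, and $\varphi(a)\leq a$ for every $\mathfrak{m}$-$\mathcal{L}$-generated element $a\in\mathcal{L}$ and for all $\varphi\in\mathfrak{m}$.
   Context: $\mathbf{0},\mathbf{1}$ denote the least and greatest elements; $[a,b]=\{x: a\le x\le b\}$. An element $x$ has a complement if there is $x'$ with $x\wedge x'=\mathbf{0}$, $x\vee x'=\mathbf{1}$. Linear morphism: a map $\varphi:\mathcal{L}\to\mathcal{L}'$ between bounded lattices is linear if there exist $\ker_\varphi\in\mathcal{L}$ and $a'\in\mathcal{L}'$ such that (1) $\varphi(x)=\varphi(x\vee\ker_\varphi)$ for all $x$; (2) $\varphi$ restricts to a lattice isomorphism $[\ker_\varphi,\mathbf{1}]\to[\mathbf{0},a']$ (so $a'=\varphi(\mathbf{1})$). $\mathrm{End}_{lin}(\mathcal{L})$ is the monoid of linear morphisms $\mathcal{L}\to\mathcal{L}$ under composition; its zero is the constant map $\mathbf{0}$. A submonoid with zero contains the identity and the zero morphism. For $x$ with complement $x'$, the projection $\pi_x$ (with respect to $x'$) is $\pi_x(a)=(a\vee x')\wedge x$, viewed with codomain $\mathcal{L}$ or $[\mathbf{0},x]$; $\iota_x:[\mathbf{0},x]\to\mathcal{L}$ is the inclusion. $\mathfrak{m}$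 is closed under complements if for every $\varphi\in\mathfrak{m}$ and all $x,y$ having complements in $\mathcal{L}$ such that $\varphi$ restricts to an isomorphism $\varphi|_x:[\mathbf{0},x]\to[\mathbf{0},y]$, one has $\iota_x(\varphi|_x)^{-1}\pi_y\in\mathfrak{m}$ (for every choice of complement of $y$ defining $\pi_y$). $\mathcal{L}$ is $\mathfrak{m}$-endoregular if for each $\varphi\in\mathfrak{m}$ there is $\psi\in\mathfrak{m}$ with $\varphi=\varphi\psi\varphi$; $\mathfrak{m}$-abelian if every idempotent of $\mathfrak{m}$ is central in $\mathfrak{m}$; $\mathfrak{m}$-abelian-endoregular if it is both. An element $a\in\mathcal{L}$ is $\mathfrak{m}$-$\mathcal{L}$-generated if there is a family of linear morphisms $\{\varphi_i:\mathcal{L}\to[\mathbf{0},a]\}_{i\in I}$ with $\iota_a\varphi_i\in\mathfrak{m}$ for all $i$ and $\bigvee_{i\in I}\varphi_i(\mathbf{1})=a$. *)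

(* Defs.v *)
From HB Require Import structures.
From mathcomp Require Import all_boot all_order.
From mathcomp Require Import interval boolp classical_sets functions set_interval.

Set Implicit Arguments.
Unset Strict Implicit.
Unset Printing Implicit Defensive.
Import Order.LTheory.

Local Open Scope order_scope.

Definition complete_lattice d (L : tbLatticeType d) : Prop :=
  forall A : set L,
    (exists s, supremums A s) /\ (exists i, infimums A i).

Definition modular_lattice d (L : tbLatticeType d) : Prop :=
  forall x y z : L, x <= z -> x `|` (y `&` z) = (x `|` y) `&` z.

Definition is_complement d (L : tbLatticeType d) (x x' : L) : Prop :=
  x `&` x' = \bot /\ x `|` x' = \top.

Definition has_complement d (L : tbLatticeType d) (x : L) : Prop :=
  exists x', is_complement x x'.

(* The projection onto [x] along [x'], seen as a map from [L] to itself. *)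
Definition projection d (L : tbLatticeType d) (x x' : L) : L -> L :=
  fun a => (a `|` x') `&` x.

Section LowerInterval.
Context {d : Order.disp_t} {L : tbLatticeType d}.

(* The bounded lattice [\bot, a]. Its greatest element is [a], so it is not a
   TBSubLattice of [L]: its top has to be supplied separately. *)
Record lower_interval (a : L) := LowerInterval {
  lower_val : L;
  _ : lower_val <= a }.

Variable a : L.
HB.instance Definition _ := [isSub for @lower_val a].
HB.instance Definition _ := [Choice of lower_interval a by <:].

Fact lower_interval_meet_closed : meet_closed (fun x : L => x <= a).
Proof. by move=> x y xa _; apply: le_trans (leIl x y) xa. Qed.

Fact lower_interval_join_closed : join_closed (fun x : L => x <= a).
Proof. by move=> x y xa ya; rewrite unfold_in leUx; apply/andP; split. Qed.

HB.instance Definition _ :=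
  Order.SubChoice_isSubLattice.Build d L (fun x => x <= a) d (lower_interval a)
    lower_interval_meet_closed lower_interval_join_closed.

Fact lower_interval_le0x (u : lower_interval a) :
  LowerInterval (le0x a) <= u.
Proof. by rewrite -Order.le_val le0x. Qed.

Fact lower_interval_lex1 (u : lower_interval a) :
  u <= LowerInterval (lexx a).
Proof. by rewrite -Order.le_val; exact: (valP u). Qed.

HB.instance Definition _ :=
  Order.hasBottom.Build d (lower_interval a) lower_interval_le0x.
HB.instance Definition _ :=
  Order.hasTop.Build d (lower_interval a) lower_interval_lex1.

End LowerInterval.

(* [f] restricts to a lattice isomorphism from [A] onto [B]. It is only used
   for sublattices [A] and [B]. *)
Definition restricts_to_iso d d' (L : latticeType d) (L' : latticeType d')
    (A : set L) (B : set L') (f : L -> L') : Prop :=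
  [/\ set_bij A B f,
      {in A &, {morph f : x y / x `&` y}} &
      {in A &, {morph f : x y / x `|` y}}].

Definition linear_morphism d d' (L : tbLatticeType d) (L' : tbLatticeType d')
    (phi : L -> L') : Prop :=
  exists (k : L) (a' : L'),
    (forall x, phi x = phi (x `|` k)) /\
    restricts_to_iso `[k, \top]%classic `[\bot, a']%classic phi.

Section Submonoids.
Context {d : Order.disp_t} {L : tbLatticeType d}.
Variable m : set (L -> L).

Definition submonoid_with_zero : Prop :=
  [/\ (forall phi, m phi -> linear_morphism phi),
      m idfun,
      m (fun=> \bot) &
      (forall phi psi, m phi -> m psi -> m (phi \o psi))].

(* [g] is any map that inverts [phi : [\bot, x] -> [\bot, y]]; its values
   outside [\bot, y] are irrelevant, since [projection y y'] takes its values
   in [\bot, y]. *)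
Definition closed_under_complements : Prop :=
  forall phi, m phi -> forall x y, has_complement x -> has_complement y ->
    restricts_to_iso `[\bot, x]%classic `[\bot, y]%classic phi ->
    forall g : L -> L, {in `[\bot, x]%classic, cancel phi g} ->
    forall y', is_complement y y' -> m (g \o projection y y').

Definition endoregular : Prop :=
  forall phi, m phi -> exists2 psi, m psi & phi = phi \o psi \o phi.

Definition abelian : Prop :=
  forall e, m e -> e \o e = e -> forall phi, m phi -> e \o phi = phi \o e.

Definition abelian_endoregular : Prop := abelian /\ endoregular.

Definition generated (a : L) : Prop :=
  exists (I : Type) (phi : I -> L -> lower_interval a),
    [/\ (forall i, linear_morphism (phi i)),
        (forall i, m (@lower_val d L a \o phi i)) &
        supremums (range (fun i => lower_val (phi i \top))) a].

End Submonoids.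

(* Main.v *)
Require Import Defs.
From mathcomp Require Import all_boot all_order.
From mathcomp Require Import classical_sets.
From mathcomp Require Import interval boolp.

(** A linear morphism with kernel [k] preserves joins and kills exactly the
    difference between [x] and [x `|` k]: [phi x <= phi y] forces
    [x <= y `|` k] ([linear_morphism_kernel]).

    Abelian endoregular implies invariance: if [phi_i = phi_i psi_i phi_i], then
    [phi_i psi_i] is an idempotent of [m] with the same image as [phi_i], and it
    commutes with each [phi] in [m], so [phi (phi_i \top) <= phi_i \top].  These
    inequalities pass to the supremum because [phi x <= a] is equivalent to
    [x <= b] for some [b] ([linear_morphism_adjoint]).

    Invariance implies abelian: let [e] be an idempotent of [m] with kernel [k].
    Then [k] and [e \top] are complements ([idempotent_kernel_complement]), and
    closure under complements, applied to the identity, puts the projection onto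
    [k] in [m].  Both [e \top] and [k] are then values at [\top] of members
    of [m], hence generated ([generated_top]), so every [phi] in [m] maps each
    of them below itself.  From [x `|` k = e x `|` k] and [phi k <= k] one gets
    [e (phi x) = e (phi (e x))]; from [phi (e \top) <= e \top], on which [e] is
    the identity, one gets [e (phi (e x)) = phi (e x)]. *)

Set Implicit Arguments.
Unset Strict Implicit.
Unset Printing Implicit Defensive.
Import Order.LTheory.

Local Open Scope order_scope.

Section LinearMorphism.
Context {d : Order.disp_t} {L : tbLatticeType d}.
Implicit Types (phi : L -> L) (x y k : L).

Lemma in_segmentE d' (T : porderType d') (a b z : T) :
  (z \in `[a, b]%classic) = (a <= z <= b).
Proof. by apply/idP/idP; rewrite inE /= in_itv. Qed.

Lemma in_segment_topE d' (T : tbLatticeType d') (a z : T) :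
  (z \in `[a, \top]%classic) = (a <= z).
Proof. by rewrite in_segmentE lex1 andbT. Qed.

Lemma in_segment_botE d' (T : tbLatticeType d') (b z : T) :
  (z \in `[\bot, b]%classic) = (z <= b).
Proof. by rewrite in_segmentE le0x. Qed.

(** What remains of linearity once the segments are eliminated. Since [phi k]
    is [\bot], the third condition makes [k] the largest element sent to
    [\bot]; the last one says that the image is a whole lower segment. *)
Definition kernel_spec phi k : Prop :=
  [/\ phi k = \bot,
      {morph phi : x y / x `|` y},
      (forall x y, phi x <= phi y -> x <= y `|` k) &
      (forall y, y <= phi \top -> exists x, phi x = y)].

(** The isomorphism [[k, \top] -> [\bot, a']] is pulled back along
    [x |-> x `|` k], which turns the conditions on the segment into conditions
    on the whole lattice. *)
Lemma linear_morphism_kernel phi : linear_morphism phi ->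
  exists k, kernel_spec phi k.
Proof.
move=> [k [a' [phik [[phi_fun phi_inj phi_surj] _ phiU]]]].
have kU x : x `|` k \in `[k, \top]%classic by rewrite in_segment_topE leUr.
have phiD : {morph phi : x y / x `|` y}.
  move=> x y; rewrite phik (phik x) (phik y) -phiU //.
  by rewrite joinACA joinxx.
have phi_le x y : x <= y -> phi x <= phi y.
  by move=> /join_r xy; rewrite -xy phiD leUl.
have surj y : y <= a' -> exists2 x, k <= x & phi x = y.
  move=> ya'.
  have : `[\bot, a']%classic y by apply/set_mem; rewrite in_segment_botE.
  by move=> /phi_surj [x /mem_set]; rewrite in_segment_topE => kx <-; exists x.
have phi_top : phi \top <= a'.
  rewrite -in_segment_botE; apply/mem_set/phi_fun/set_mem.
  by rewrite in_segment_topE lex1.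
exists k; split=> //.
- have [x kx phix] := surj \bot (le0x _).
  by apply: le_anti; rewrite le0x andbT -phix phi_le.
- move=> x y /join_r xy.
  suff -> : y `|` k = (y `|` k) `|` (x `|` k) by rewrite lexU2 // leUl orbT.
  apply: phi_inj => //; first by rewrite in_segment_topE !lexU2 ?lexx ?orbT.
  by rewrite [in RHS]phiD -!phik joinC xy.
- by move=> y ya; have [x _ <-] := surj y (le_trans ya phi_top); exists x.
Qed.

Section KernelSpec.
Variables (phi : L -> L) (k : L).
Hypothesis phi_k : kernel_spec phi k.

Lemma kernel_spec_mono x y : x <= y -> phi x <= phi y.
Proof. by case: phi_k => _ phiU _ _ /join_r <-; rewrite phiU leUl. Qed.

Lemma kernel_spec_joink x : phi (x `|` k) = phi x.
Proof. by case: phi_k => phik0 phiU _ _; rewrite phiU phik0 joinx0. Qed.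

Lemma kernel_spec_le_kernel x : x <= k -> phi x = \bot.
Proof.
case: phi_k => phik0 _ _ _ /kernel_spec_mono; rewrite phik0 => phix.
by apply: le_anti; rewrite phix le0x.
Qed.

End KernelSpec.

(** The value at [a] of the right adjoint of [phi]; its existence is what makes
    [phi] compatible with arbitrary suprema. *)
Lemma linear_morphism_adjoint phi a : linear_morphism phi ->
  exists b, forall x, (phi x <= a) = (x <= b).
Proof.
move=> /linear_morphism_kernel [k phi_k].
have [_ _ phi_ker phi_im] := phi_k.
(* [a] itself need not be a value of [phi], but its meet with [phi \top] is. *)
have [c phic] := phi_im (a `&` phi \top) (leIr _ _).
exists (c `|` k) => x; apply/idP/idP => [phixa | xc].
- by apply: phi_ker; rewrite phic lexI phixa (kernel_spec_mono phi_k) ?lex1.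
- apply: le_trans (kernel_spec_mono phi_k xc) _.
  by rewrite (kernel_spec_joink phi_k) phic leIl.
Qed.

Lemma linear_morphism_mono phi x y : linear_morphism phi ->
  x <= y -> phi x <= phi y.
Proof.
by move=> /linear_morphism_kernel [k phi_k]; exact: (kernel_spec_mono phi_k).
Qed.

Lemma linear_morphism_le_top phi x : linear_morphism phi -> phi x <= phi \top.
Proof. by move=> phi_lin; apply: linear_morphism_mono => //; exact: lex1. Qed.

Lemma linear_morphism_corestrict phi (phi_top : forall x, phi x <= phi \top) :
  linear_morphism phi ->
  linear_morphism (fun x => LowerInterval (phi_top x)).
Proof.
move=> phi_lin; have [_ [_ _ _ phi_im]] := linear_morphism_kernel phi_lin.
have [k [a' [phik [[_ phi_inj _] phiI phiU]]]] := phi_lin.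
exists k, \top; split; first by move=> x; apply/val_inj/phik.
split; last 2 first.
- by move=> x y xk yk; apply: val_inj; exact: phiI.
- by move=> x y xk yk; apply: val_inj; exact: phiU.
split.
- by move=> x _; apply/set_mem; rewrite in_segment_botE lex1.
- by move=> x y xk yk /(congr1 val) /= phixy; apply: phi_inj.
- move=> u _; have [x phix] := phi_im _ (valP u).
  exists (x `|` k); first by apply/set_mem; rewrite in_segment_topE leUr.
  by apply: val_inj; rewrite /= -phik.
Qed.

Section Idempotent.
Variables (e : L -> L) (k : L).
Hypotheses (e_k : kernel_spec e k) (ee : forall x, e (e x) = e x).

Lemma idempotent_fix x : x <= e \top -> e x = x.
Proof. by case: e_k => _ _ _ e_im /e_im [y <-]. Qed.

(** [x] and [e x] have the same image under [e], so they agree modulo [k]. *)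
Lemma idempotent_joink x : e x `|` k = x `|` k.
Proof.
have [_ _ e_ker _] := e_k.
by apply: le_anti; rewrite !leUx !leUr !e_ker ?ee.
Qed.

Lemma idempotent_kernel_complement : is_complement k (e \top).
Proof.
split; last by rewrite joinC idempotent_joink join1x.
by rewrite -(idempotent_fix (leIr _ _)) (kernel_spec_le_kernel e_k (leIl _ _)).
Qed.

End Idempotent.

Variable m : set (L -> L).

(** The generating family is [phi] alone, corestricted to its image. *)
Lemma generated_top phi : (forall psi, m psi -> linear_morphism psi) ->
  m phi -> generated m (phi \top).
Proof.
move=> m_lin mphi; have phi_lin := m_lin _ mphi.
have phi_top x := linear_morphism_le_top x phi_lin.
exists unit, (fun _ x => LowerInterval (phi_top x)); split=> //.
- by move=> _; apply: linear_morphism_corestrict.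
- by split=> [_ [_ _ <-] //|y]; apply; exists tt.
Qed.

(** The identity restricts to an isomorphism of [[\bot, x]], and the morphism
    that closure under complements attaches to it is the projection itself. *)
Lemma projection_closed x x' : m idfun -> closed_under_complements m ->
  is_complement x x' -> m (projection x x').
Proof.
move=> m1 m_cc xx'; have hx : has_complement x by exists x'.
have id_iso : restricts_to_iso `[\bot, x]%classic `[\bot, x]%classic (@idfun L).
  by split=> //; split=> // y xy; exists y.
exact: (m_cc idfun m1 x x hx hx id_iso idfun (fun _ _ => erefl) x' xx').
Qed.

Lemma abelian_endoregular_invariant : submonoid_with_zero m ->
  abelian_endoregular m ->
  forall a, generated m a -> forall phi, m phi -> phi a <= a.
Proof.
move=> [m_lin _ _ mM] [m_ab m_reg] a [I [f [_ mf [f_ub f_lub]]]] phi mphi.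
have [b phi_b] := linear_morphism_adjoint a (m_lin _ mphi).
rewrite phi_b; apply: f_lub => _ [i _ <-]; rewrite -phi_b.
set g := @lower_val d L a \o f i; have mg : m g := mf i.
have ga : g \top <= a by apply: f_ub; exists i.
have [psi mpsi g_reg] := m_reg g mg.
(* This idempotent has the same image as [g]. *)
pose e := g \o psi; have me : m e := mM _ _ mg mpsi.
have ee : e \o e = e by rewrite {3}/e g_reg.
have ge : g \top <= e \top.
  by rewrite {1}g_reg; apply: linear_morphism_le_top (m_lin _ me).
apply: le_trans ga.
apply: (le_trans (linear_morphism_mono (m_lin _ mphi) ge)).
have /(congr1 (@^~ \top)) /= <- := m_ab e me ee phi mphi.
exact: linear_morphism_le_top (m_lin _ mg).
Qed.

Lemma invariant_abelian : submonoid_with_zero m ->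
  closed_under_complements m ->
  (forall a, generated m a -> forall phi, m phi -> phi a <= a) -> abelian m.
Proof.
move=> [m_lin m1 _ _] m_cc m_inv e me ee' phi mphi.
have ee x : e (e x) = e x by have /(congr1 (@^~ x)) := ee'.
have [k e_k] := linear_morphism_kernel (m_lin _ me).
have [_ [_ phiU _ _]] := linear_morphism_kernel (m_lin _ mphi).
have phi_e := m_inv _ (generated_top m_lin me) _ mphi.
have phi_ker : phi k <= k.
  have mp := projection_closed m1 m_cc (idempotent_kernel_complement e_k ee).
  have := m_inv _ (generated_top m_lin mp) _ mphi.
  by rewrite /projection join1x meet1x.
have e_mod x : e (phi (x `|` k)) = e (phi x).
  have [_ eU _ _] := e_k.
  by rewrite phiU eU (kernel_spec_le_kernel e_k phi_ker) joinx0.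
apply/funext => x /=.
rewrite -e_mod -(idempotent_joink e_k ee) e_mod (idempotent_fix e_k ee) //.
apply: le_trans phi_e; apply: linear_morphism_mono (m_lin _ mphi) _.
exact: linear_morphism_le_top (m_lin _ me).
Qed.

End LinearMorphism.

Theorem proposition3p29 (d : Order.disp_t) (L : tbLatticeType d)
    (m : set (L -> L)) :
  complete_lattice L -> modular_lattice L ->
  submonoid_with_zero m -> closed_under_complements m ->
  (abelian_endoregular m <->
   (endoregular m /\
    forall a : L, generated m a ->
      forall phi : L -> L, m phi -> (phi a <= a)%O)).
Proof.
move=> _ _ m_mon m_cc; split=> [m_abreg | [m_reg m_inv]].
- by split; [exact: m_abreg.2 | exact: abelian_endoregular_invariant].
- by split=> //; exact: invariant_abelian.
Qed.
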